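(* Let $T=(T_1,\dots,T_d)$ be a contractive tuple on $H$ with $0<\Delta_T<\infty$ which is commuting, i.e. $T_iT_j=T_jT_i$ for all $1\le i,j\le d$. Then for any positive integer $n$, $$\Delta_{T^n}\le\sum_{k=0}^{n-1}\binom{k+d-1}{d-1}\,\Delta_T .$$
   Context: Fix a positive integer $d$ and a complex, separable, infinite dimensional Hilbert space $H$. A $d$-tuple $T=(T_1,\dots,T_d)$ of bounded operators on $H$ is contractive if $T_1T_1^*+\cdots+T_dT_d^*\le I$. Put $P_T(X)=\sum_{i=1}^d T_iXT_i^*$ for $X\in\mathcal B(H)$, and let $P_T^n$ be the $n$-fold iterate of $P_T$. The $n$-th defect dimension is $\Delta_{T^n}=\dim\overline{\mathrm{Range}}\,(I-P_T^n(I))$, and $\Delta_T=\Delta_{T^1}$. *)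

(* Defs.v *)
From HB Require Import structures.
From mathcomp Require Import all_boot all_order all_algebra.
From mathcomp Require Import complex sesquilinear.
From mathcomp Require Import all_classical all_reals all_analysis.

Set Implicit Arguments.
Unset Strict Implicit.
Unset Printing Implicit Defensive.

Import Order.TTheory GRing.Theory Num.Theory.
Import numFieldNormedType.Exports.

Local Open Scope classical_set_scope.
Local Open Scope ring_scope.
Local Open Scope complex_scope.

Definition separable_space (X : topologicalType) : Prop :=
  exists2 D : set X, countable D & dense D.

Section hilbert.
Context {R : realType} {H : completeNormedModType R[i]}.

(* Makes the complete normed space H a Hilbert space with inner product dot,
   which is linear in its first argument and conjugate-linear in its second. *)
Definition norm_induced_by (dot : {dot H for Num.conj}) : Prop :=
  forall x : H, `|x| ^+ 2 = dot x x.

Context (dot : {dot H for Num.conj}).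

(* For A bounded linear on a Hilbert space the relation below has exactly one
   solution B, which is again linear and bounded; the default value 0 is then
   never used. *)
Definition adjoint (A : H -> H) : H -> H :=
  xget (fun=> 0) [set B : H -> H | forall x y, dot (A x) y = dot x (B y)].

(* On R[i], 0 <= z means that z is real and nonnegative. *)
Definition op_le (A B : H -> H) : Prop :=
  forall x, 0 <= dot (B x - A x) x.

Definition lin_span (s : seq H) : set H :=
  [set \sum_(e <- s) c e *: e | c in [set: H -> R[i]]].

Definition orthonormal_basis (V : set H) (s : seq H) : Prop :=
  orthonormal dot s /\ V = lin_span s.

(* Hilbert space dimension of a closed subspace V: the number of elements of an
   orthonormal basis of V if there is a finite one, and +oo otherwise. All
   infinite cardinals are identified; if H is separable, aleph_0 is the only
   one that occurs. *)
Definition hilbert_dim (V : set H) : \bar R :=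
  xget +oo%E [set (size s)%:R%:E | s in orthonormal_basis V].

Section tuple.
Context {d : nat} (T : 'I_d -> {linear H -> H}).

Definition contractive : Prop :=
  op_le (fun x => \sum_(i < d) T i (adjoint (T i) x)) id.

Definition commuting : Prop :=
  forall (i j : 'I_d) (x : H), T i (T j x) = T j (T i x).

Definition PT (X : H -> H) : H -> H :=
  fun x => \sum_(i < d) T i (X (adjoint (T i) x)).

Definition defect_dim (n : nat) : \bar R :=
  hilbert_dim (closure (range (fun x : H => x - iter n PT id x))).

End tuple.

End hilbert.

(* Main.v *)
Require Import Defs.
From HB Require Import structures.
From mathcomp Require Import all_boot all_order all_algebra.
From mathcomp Require Import complex sesquilinear.
From mathcomp Require Import all_classical all_reals all_analysis.

Set Implicit Arguments.
Unset Strict Implicit.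
Unset Printing Implicit Defensive.

Import Order.TTheory GRing.Theory Num.Theory.
Import numFieldNormedType.Exports.

Local Open Scope classical_set_scope.
Local Open Scope ring_scope.
Local Open Scope complex_scope.

(** Write D = I - P_T(I). Since P_T is additive, I - P_T^n(I) telescopes to the
    sum of P_T^k(D) over k < n. Expanding P_T^k(D) as a sum over the words w of
    length k in the indices shows that its range lies in the span of the images
    T_w (Range D), where T_w is the product of the T_i along w. The operators
    commute, so T_w depends only on the sorted rearrangement of w, and there are
    binomial(k+d-1, d-1) sorted words of length k. As Range D is contained in
    the span of Delta_T vectors, Range (I - P_T^n(I)) is contained in the span
    of as many vectors as the bound announces: this is [defect_span] together
    with [size_monomial_images].

    It remains to compare the Hilbert dimension of the closure of a subspace W
    with the number of vectors of a spanning list t ([hilbert_dim_closure_le]).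
    An orthonormal family in the span of t has at most as many elements as t
    ([orthonormal_size]), so W has an orthonormal family of maximal size; by
    maximality it spans W, and the span of an orthonormal family is closed by
    the Pythagorean theorem. Hence W is its own closure and has a finite
    orthonormal basis, and every such basis is bounded by the size of t. That W
    is a subspace rests on the linearity of adjoints ([adjoint_linear]). *)

(** * Linear spans *)

Section span.
Context {R : realType} {H : completeNormedModType R[i]}.
Implicit Types (s t : seq H) (W : set H).

Definition subspace W : Prop :=
  W 0 /\ forall (a : R[i]) u v, W u -> W v -> W (a *: u + v).

Lemma subspace_sum W (I : Type) (r : seq I) (F : I -> H) :
  subspace W -> (forall i, W (F i)) -> W (\sum_(i <- r) F i).
Proof.
move=> [W0 WP] WF; elim/big_ind: _ => // x y Wx Wy.
by rewrite -[x]scale1r; apply: WP.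
Qed.

Lemma lin_span_subspace s : subspace (lin_span s).
Proof.
split; first by exists (fun=> 0) => //; rewrite big1 // => e _; rewrite scale0r.
move=> a _ _ [c _ <-] [c' _ <-]; exists (fun e => a * c e + c' e) => //.
rewrite scaler_sumr -big_split /=; apply: eq_bigr => e _.
by rewrite scalerA scalerDl.
Qed.

Lemma mem_lin_span s e : e \in s -> lin_span s e.
Proof.
move=> es.
(* Repeated entries of s share one coefficient, hence the division by the
   multiplicity of e. *)
exists (fun f => (f == e)%:R / (count_mem e s)%:R) => //.
rewrite (bigID (pred1 e)) /= [X in _ + X]big1 ?addr0; last first.
  by move=> f /negbTE ->; rewrite mul0r scale0r.
rewrite (eq_bigr (fun=> (count_mem e s)%:R^-1 *: e)); last first.
  by move=> f /eqP ->; rewrite eqxx mul1r.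
rewrite big_const_seq iter_addr addr0 -scaler_nat scalerA mulfV ?scale1r//.
by rewrite pnatr_eq0 -lt0n -has_count has_pred1.
Qed.

Lemma lin_span_image (f : {linear H -> H}) s W x :
  subspace W -> {in s, forall e, W (f e)} -> lin_span s x -> W (f x).
Proof.
move=> [W0 WP] sW [c _ <-]; rewrite linear_sum big_seq.
elim/big_ind: _ => // [u v Wu Wv|e es]; first by rewrite -[u]scale1r; exact: WP.
by rewrite linearZ -[X in W X]addr0; apply: WP => //; exact: sW.
Qed.

Lemma lin_span_sub s W : subspace W -> {in s, forall e, W e} -> lin_span s `<=` W.
Proof. by move=> subW sW x; apply: (@lin_span_image idfun). Qed.

Lemma range_subspace (f : {linear H -> H}) : subspace (range f).
Proof.
split; first by exists 0 => //; rewrite linear0.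
by move=> a _ _ [u _ <-] [v _ <-]; exists (a *: u + v) => //; rewrite linearP.
Qed.

End span.

(** * Hilbert dimension of a finite-dimensional subspace *)

Section hilbert.
Context {R : realType} {H : completeNormedModType R[i]}.
Variable dot : {dot H for Num.conj}.
Implicit Types (s t : seq H) (V W : set H).

(** Were s longer than t, the matrix of the coefficients of s over t would have
    a nonzero row vector u in its left kernel. Then the combination of s with
    coefficients u vanishes, and pairing it with each entry of s gives u = 0. *)
Lemma orthonormal_size s t :
  orthonormal dot s -> {in s, forall e, lin_span t e} -> (size s <= size t)%N.
Proof.
move=> /orthonormalP[us os] st; rewrite leqNgt; apply/negP => ltts.
have /choice[c cP] : forall e, exists c : H -> R[i],
    e \in s -> e = \sum_(f <- t) c f *: f.
  move=> e; have [es|nes] := boolP (e \in s); last by exists (fun=> 0).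
  by have [c _ <-] := st _ es; exists c.
pose A := \matrix_(i < size s, j < size t) c s`_i t`_j.
have : kermx A != 0.
  by rewrite kermx_eq0 -row_leq_rank -ltnNge (leq_ltn_trans (rank_leq_col A)).
rewrite -nz_row_eq0 => /eqP[]; set u := nz_row _.
have uA : u *m A = 0 by apply/sub_kermxP/nz_row_sub.
have us0 : \sum_(i < size s) u 0 i *: s`_i = 0.
  transitivity (\sum_(j < size t) (u *m A) 0 j *: t`_j); last first.
    by rewrite uA big1 // => j _; rewrite mxE scale0r.
  under [RHS]eq_bigr do rewrite mxE scaler_suml.
  rewrite exchange_big; apply: eq_bigr => i _.
  rewrite {1}(cP s`_i) ?mem_nth // (big_nth 0) big_mkord scaler_sumr.
  by apply: eq_bigr => j _; rewrite mxE scalerA.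
apply/rowP => k; rewrite mxE.
have := congr1 (dot^~ s`_k) us0; rewrite linear_sumlz linear0l => <-.
rewrite (bigD1 k) //= linearZl_LR [X in _ * X]os ?mem_nth // eqxx mulr1 big1 ?addr0 //.
move=> i; rewrite -val_eqE /= => /negbTE ik.
by rewrite linearZl_LR [X in _ * X]os ?mem_nth // nth_uniq // ik mulr0.
Qed.

Definition orthoproj s x := \sum_(e <- s) dot x e *: e.

Lemma orthoproj_span s x : lin_span s (orthoproj s x).
Proof. by exists (dot x). Qed.

Lemma orthoproj_residue s x w :
  orthonormal dot s -> lin_span s w -> dot (x - orthoproj s x) w = 0.
Proof.
move=> /orthonormalP[us os] [c _ <-].
rewrite linear_sumr big_seq big1 // => e es.
suff xe : dot (x - orthoproj s x) e = 0 by rewrite linearZr_LR /= [X in _ * X]xe mulr0.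
rewrite linearBl linear_sumlz (bigD1_seq e) //= linearZl_LR [X in _ * X]os // eqxx mulr1.
rewrite big_seq_cond big1 ?addr0 ?subrr // => f /andP[fs fe].
by rewrite linearZl_LR [X in _ * X]os // (negbTE fe) mulr0.
Qed.

(** One Gram-Schmidt step: sqrtC (dot y y) is the norm of y. *)
Lemma orthonormal_extend s y : orthonormal dot s -> y != 0 ->
  {in s, forall e, dot y e = 0} ->
  orthonormal dot ((sqrtC (dot y y))^-1 *: y :: s).
Proof.
move=> os y0 ys; move: (os) => /andP[/allP s1 opr]; apply/andP; split=> /=.
  apply/andP; split; last exact/allP.
  have r0 : 0 <= (sqrtC (dot y y))^-1 by rewrite invr_ge0 sqrt_dnorm_ge0.
  by rewrite dnormZ ger0_norm // exprVn sqrtCK mulVf // dnorm_eq0.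
rewrite opr !andbT; apply/allP => e es /=.
by rewrite linearZl_LR [X in _ * X]ys // mulr0.
Qed.

(** An orthonormal list in W of maximal size spans W: otherwise some w in W has
    a nonzero residue modulo its projection, and normalizing that residue
    lengthens the list. *)
Lemma subspace_orthonormal_basis W t : subspace W -> W `<=` lin_span t ->
  exists s, orthonormal_basis dot W s.
Proof.
move=> subW Wt.
pose P k := `[< exists s, [/\ orthonormal dot s, {in s, forall e, W e}
  & size s = k] >].
have exP : exists k, P k by exists 0%N; apply/asboolP; exists [::].
have leP k : P k -> (k <= size t)%N.
  move=> /asboolP[s [os sW <-]]; apply: orthonormal_size os _ => e /sW.
  exact: Wt.
have [k /asboolP[s [os sW ks]] kmax] := ex_maxnP exP leP.
exists s; split=> //; apply/seteqP; split; last exact: lin_span_sub.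
move=> w Ww; set y := w - orthoproj s w.
have ys : {in s, forall e, dot y e = 0}.
  by move=> e es; apply: orthoproj_residue os (mem_lin_span es).
have [y0|y0] := eqVneq y 0.
  by rewrite -[w](subrK (orthoproj s w)) -/y y0 add0r; exact: orthoproj_span.
have Wy : W y.
  rewrite /y addrC -scaleN1r; apply: subW.2 => //.
  by apply: lin_span_sub (orthoproj_span s w).
suff /kmax : P k.+1 by rewrite ltnn.
apply/asboolP; exists ((sqrtC (dot y y))^-1 *: y :: s); split.
- exact: orthonormal_extend.
- move=> e; rewrite inE => /orP[/eqP ->|]; last exact: sW.
  by rewrite -[X in W X]addr0; apply: subW.2 => //; exact: subW.1.
- by rewrite /= ks.
Qed.

(** For w in the span, x - w is the orthogonal sum of the residue
    y = x - orthoproj s x and of a vector of the span, so `|y| <= `|x - w|.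
    A limit x of such w therefore has y = 0, that is, equals its projection. *)
Lemma closure_lin_span s : norm_induced_by dot -> orthonormal dot s ->
  closure (lin_span s) = lin_span s.
Proof.
move=> Hdot os; apply/seteqP; split; last exact: subset_closure.
move=> x clx; set y := x - orthoproj s x.
have [y0|y0] := eqVneq y 0.
  by rewrite -[x](subrK (orthoproj s x)) -/y y0 add0r; exact: orthoproj_span.
have [|w [ws]] := clx (ball x `|y|); first by apply: nbhsx_ballx; rewrite normr_gt0.
rewrite -ball_normE /= => ltxw; exfalso; move: ltxw; apply/negP.
rewrite -real_leNgt ?normr_real // -(@ler_pXn2r _ 2) ?nnegrE // !Hdot.
have -> : x - w = y + (orthoproj s x - w) by rewrite /y addrA subrK.
rewrite [leRHS]hnormDd ?lerDl ?dnorm_ge0 //; apply: orthoproj_residue => //.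
rewrite addrC -scaleN1r; apply: (lin_span_subspace s).2 => //.
exact: orthoproj_span.
Qed.

Lemma hilbert_dim_closure_le W t : norm_induced_by dot ->
  subspace W -> W `<=` lin_span t ->
  (hilbert_dim dot (closure W) <= (size t)%:R%:E)%E.
Proof.
move=> Hdot subW Wt; have [s [os Ws]] := subspace_orthonormal_basis subW Wt.
have -> : closure W = W by rewrite Ws closure_lin_span.
rewrite /hilbert_dim; case: xgetP => [_ _ [s' [os' Ws'] <-]|noB]; last first.
  by case: (noB (size s)%:R%:E); exists s.
rewrite lee_fin ler_nat; apply: orthonormal_size os' _ => e es'; apply: Wt.
by rewrite Ws'; exact: mem_lin_span.
Qed.

Lemma hilbert_dim_fin V : (hilbert_dim dot V < +oo)%E ->
  exists2 s, V = lin_span s & hilbert_dim dot V = (size s)%:R%:E.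
Proof.
rewrite /hilbert_dim; case: xgetP => [_ -> [s [os Vs] <-] _|_]; last by rewrite ltxx.
by exists s.
Qed.

(** Nondegeneracy of dot determines the values of an adjoint, which makes it
    linear; where A has no adjoint, the default value 0 is linear as well. *)
Lemma adjoint_linear (A : H -> H) : linear (adjoint dot A).
Proof.
rewrite /adjoint; case: xgetP => [B _ AB|_] a u v; last by rewrite scaler0 addr0.
apply/eqP; rewrite -subr_eq0 -(dnorm_eq0 dot); apply/eqP; set z := _ - _.
have dotP w u' v' : dot w (a *: u' + v') = a^* * dot w u' + dot w v'.
  by rewrite linearDr linearZr_LR.
rewrite [in X in dot _ X]/z linearBr; apply/eqP; rewrite subr_eq0; apply/eqP.
by rewrite -[LHS]AB [RHS]dotP [LHS]dotP -!AB.
Qed.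

End hilbert.

(** * Words in a commuting tuple *)

Section words.
Context {R : realType} {H : completeNormedModType R[i]} {d : nat}.
Variable T : 'I_d -> {linear H -> H}.
Implicit Types (w : seq 'I_d) (s : seq H).

Definition word_op w (x : H) : H := foldr (fun i => T i) x w.

(** Moving the letter i to the front of the second word does not change its
    operator, and then both words start with i. *)
Lemma word_op_perm w w' x :
  commuting T -> perm_eq w w' -> word_op w x = word_op w' x.
Proof.
move=> Tcomm.
have move_front i v y : T i (word_op v y) = word_op v (T i y).
  by elim: v => //= j v IH; rewrite Tcomm IH.
elim: w w' => [|i w IH] w' ww'.
  by rewrite perm_sym in ww'; rewrite (perm_nilP ww').
have : i \in w' by rewrite -(perm_mem ww') mem_head.
move=> /path.splitPr Ew'; case: Ew' ww' => v1 v2 ww'.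
have /IH wv : perm_eq w (v1 ++ v2).
  by rewrite -(perm_cons i) (perm_trans ww') //; exact/permPl/(perm_catCA v1 [:: i]).
rewrite [LHS]/= -/(word_op w x) wv.
by rewrite /word_op !foldr_cat /=; exact: move_front.
Qed.

(** Sorted words of length k stand for the monomials of degree k in d commuting
    variables. *)
Definition sorted_words k : seq (k.-tuple 'I_d) :=
  [seq v : k.-tuple 'I_d <- enum {: k.-tuple 'I_d} | sorted leq (map val v)].

Definition monomial_images k s : seq H :=
  [seq word_op (tval v) e | v <- sorted_words k, e <- s].

Lemma word_op_monomial_images w s e : commuting T -> e \in s ->
  word_op w e \in monomial_images (size w) s.
Proof.
move=> Tcomm es; pose v := sort (relpre val leq) w.
have vw : size v == size w by rewrite size_sort.
apply/allpairsP; exists (Tuple vw, e); split=> //=.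
  rewrite mem_filter mem_enum andbT sorted_map.
  by apply: sort_sorted => i j; exact: leq_total.
by apply: word_op_perm => //; rewrite perm_sym perm_sort.
Qed.

Variable S : 'I_d -> H -> H.

(** One application of P_T raises the degree of the monomials by one. The right
    factors S i only move the argument of X, so the inclusion of ranges holds
    for arbitrary functions in their place. *)
Lemma conj_sum_monomial_images k s (X : H -> H) : commuting T ->
  (forall x, lin_span (monomial_images k s) (X x)) ->
  forall x, lin_span (monomial_images k.+1 s) (\sum_(i < d) T i (X (S i x))).
Proof.
move=> Tcomm Xk x; apply: subspace_sum => [|i]; first exact: lin_span_subspace.
apply: lin_span_image (Xk _); first exact: lin_span_subspace.
move=> _ /allpairsP[[w e] [_ /= es ->]]; apply: mem_lin_span.
by have := word_op_monomial_images (i :: w) Tcomm es; rewrite /= size_tuple.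
Qed.

End words.

Lemma size_monomial_images (R : realType) (H : completeNormedModType R[i])
    (d : nat) (T : 'I_d.+1 -> {linear H -> H}) k s :
  size (monomial_images T k s) = ('C(k + d, k) * size s)%N.
Proof.
rewrite size_allpairs -card_sorted_tuples; congr (_ * _)%N.
by rewrite size_filter -sum1_count big_enum_cond /= sum1dep_card.
Qed.

(** * The defect operators *)

Section defect.
Context {R : realType} {H : completeNormedModType R[i]}.
Variable dot : {dot H for Num.conj}.
Context {d : nat} (T : 'I_d -> {linear H -> H}).

Definition defect n (x : H) : H := x - iter n (PT dot T) id x.

Lemma iter_PT_linear n : linear (iter n (PT dot T) id).
Proof.
elim: n => [|n IH] a u v //=; rewrite /PT scaler_sumr -big_split /=.
by apply: eq_bigr => i _; rewrite adjoint_linear IH linearP.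
Qed.

Lemma defect_linear n : linear (defect n).
Proof.
move=> a u v; rewrite /defect iter_PT_linear scalerBr opprD.
by rewrite addrACA.
Qed.

HB.instance Definition _ n :=
  GRing.isLinear.Build _ _ _ _ (defect n) (defect_linear n).

(** P_T is additive in its operator argument, since each T i is; this lets
    P_T^k(I) - P_T^(k+1)(I) be rewritten as P_T^k applied to I - P_T(I). *)
Lemma PT_defect k x : iter k (PT dot T) id x - iter k.+1 (PT dot T) id x =
  iter k (PT dot T) (defect 1) x.
Proof.
elim: k x => // k IH x.
rewrite [in RHS]iterS /PT -/(PT dot T).
under [RHS]eq_bigr do rewrite -IH linearB.
by rewrite sumrB.
Qed.

Lemma defect_telescope n x :
  defect n x = \sum_(0 <= k < n) iter k (PT dot T) (defect 1) x.
Proof.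
under eq_bigr do rewrite -PT_defect.
elim: n => [|n IH]; first by rewrite big_geq // /defect subrr.
by rewrite big_nat_recr //= -IH /defect addrA subrK.
Qed.

Lemma defect_span n s x : commuting T -> range (defect 1) `<=` lin_span s ->
  lin_span (flatten [seq monomial_images T k s | k <- iota 0 n]) (defect n x).
Proof.
move=> Tcomm Ds; rewrite defect_telescope.
have subW := lin_span_subspace
  (flatten [seq monomial_images T k s | k <- iota 0 n]).
have Dk k y : lin_span (monomial_images T k s) (iter k (PT dot T) (defect 1) y).
  elim: k y => [|k IH]; last exact: conj_sum_monomial_images.
  move=> y; have /Ds : range (defect 1) (defect 1 y) by exists y.
  apply: lin_span_sub; first exact: lin_span_subspace.
  move=> e es; apply: mem_lin_span.
  exact: (word_op_monomial_images [::] Tcomm es).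
rewrite big_nat_cond; elim/big_ind: _ => [|u v Wu Wv|k /andP[/= kn _]].
- exact: subW.1.
- by rewrite -[u]scale1r; exact: subW.2.
apply: lin_span_sub (Dk k x) => // e ek; apply: mem_lin_span.
by apply/flatten_mapP; exists k => //; rewrite mem_iota.
Qed.

End defect.

Theorem lemma4p1 (R : realType) (H : completeNormedModType R[i])
    (dot : {dot H for Num.conj}) (Hdot : norm_induced_by dot)
    (Hsep : separable_space H)
    (Hinf : hilbert_dim dot [set: H] = +oo%E)
    (d : nat) (d_gt0 : (0 < d)%N)
    (T : 'I_d -> {linear H -> H})
    (Tbounded : forall i, bounded_near (T i) (nbhs (0 : H)))
    (Tcontr : contractive dot T)
    (Delta_gt0 : (0 < defect_dim dot T 1)%E)
    (Delta_fin : (defect_dim dot T 1 < +oo)%E)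
    (Tcomm : commuting T)
    (n : nat) (n_gt0 : (0 < n)%N) :
  (defect_dim dot T n <=
     \sum_(0 <= k < n) 'C(k + d - 1, d - 1)%:R%:E * defect_dim dot T 1)%E.
Proof.
case: d d_gt0 T {Tbounded Tcontr Delta_gt0} Delta_fin Tcomm => // d _ T.
move=> /hilbert_dim_fin[s Ds dimD] Tcomm.
have D1s : range (defect dot T 1) `<=` lin_span s.
  by rewrite -Ds; exact: subset_closure.
pose t := flatten [seq monomial_images T k s | k <- iota 0 n].
have Dt : range (defect dot T n) `<=` lin_span t.
  by move=> _ [x _ <-]; exact: defect_span.
apply: le_trans (hilbert_dim_closure_le Hdot (range_subspace _) Dt) _.
(* What is left is to count t degree by degree. *)
rewrite [defect_dim dot T 1]dimD; under eq_bigr do rewrite -EFinM -natrM.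
rewrite sumEFin lee_fin -natr_sum ler_nat size_flatten /shape -map_comp.
rewrite sumnE big_map /index_iota subn0; apply: leq_sum => k _ /=.
by rewrite size_monomial_images addnS !subSS !subn0 -(bin_sub (leq_addl k d)) addnK.
Qed.
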